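(* Let $q$ be a prime power, $e\ge1$, $Q=q^e$, and let $n\ge0$, $k\ge1$, $\ell\ge1$ be integers with $\gcd(\ell,Q-1)=1$. Then the following hold: (a) $g_{n,q}^{(\ell)}\in\mathbb{F}_Q[X_1,\dots,X_k]$ is a permutation polynomial in $k$ variables over $\mathbb{F}_Q$ if and only if $g_{n,q}(X)$ is a permutation polynomial over $\mathbb{F}_Q$; (b) $g_{n,q}^{(\ell)}$ is a local permutation polynomial over $\mathbb{F}_Q$ if and only if $g_{n,q}(X)$ is a permutation polynomial over $\mathbb{F}_Q$.
   Context: For a prime power $q$ (a power of the prime $p$) and an integer $n\ge 0$, $g_{n,q}\in\mathbb{F}_p[X]$ denotes the unique polynomial satisfying $\sum_{a\in\mathbb{F}_q}(X+a)^n=g_{n,q}(X^q-X)$. For $\ell\ge1$, $g_{n,q}^{(\ell)}(X_1,\dots,X_k)=g_{n,q}(X_1^\ell+X_2^\ell+\cdots+X_k^\ell)$. A polynomial $f\in\mathbb{F}_Q[X]$ is a permutation polynomial over $\mathbb{F}_Q$ if it induces a bijection of $\mathbb{F}_Q$. A polynomial $f\in\mathbb{F}_Q[X_1,\dots,X_k]$ is a permutation polynomial in $k$ variables over $\mathbb{F}_Q$ if for each $\alpha\in\mathbb{F}_Q$ the equation $f(X_1,\dots,X_k)=\alpha$ has exactly $Q^{k-1}$ solutions in $\mathbb{F}_Q^k$. It is a local permutation polynomial if for each $1\le i\le k$ and all choices of $a_j\in\mathbb{F}_Q$ ($j\ne i$), the univariate polynomial $f(a_1,\dots,a_{i-1},X_i,a_{i+1},\dots,a_k)$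 is a permutation polynomial over $\mathbb{F}_Q$. *)

(* Defs.v *)
From HB Require Import structures.
From mathcomp Require Import all_boot all_order all_algebra all_field.
From mathcomp Require Import mpoly.

Set Implicit Arguments.
Unset Strict Implicit.
Unset Printing Implicit Defensive.

Import GRing.Theory.
Local Open Scope ring_scope.

(* The canonical map F_p -> R. It is a ring morphism only when R has
   characteristic p (Fp_embD, Fp_emb1 and Fp_embM below). *)
Definition Fp_emb (p : nat) (R : nzRingType) (c : 'F_p) : R := (c : nat)%:R.

(* g satisfies the identity that characterizes g_{n,q} for q = #|Fq|;
   by gnq_exists_unique there is exactly one such g. *)
Definition is_gnq (p : nat) (Fq : finFieldType) (n : nat) (g : {poly 'F_p}) :
    Prop :=
  \sum_(a : Fq) ('X + a%:P) ^+ n =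
    map_poly (Fp_emb Fq) g \Po ('X^#|Fq| - 'X).

Definition perm_poly (F : finFieldType) (f : {poly F}) : Prop :=
  bijective (fun x : F => f.[x]).

(* f(X_1^l + ... + X_k^l) *)
Definition power_sum_subst (R : comNzRingType) (k l : nat) (f : {poly R}) :
    {mpoly R[k]} :=
  (map_poly (@mpolyC k R) f).[\sum_(i < k) 'X_i ^+ l].

(* Meaningful for 0 < k, because of the truncated k - 1. *)
Definition mperm_poly (F : finFieldType) (k : nat) (f : {mpoly F[k]}) : Prop :=
  forall alpha : F,
    #|[set v : {ffun 'I_k -> F} | f.@[v] == alpha]| = (#|F| ^ (k - 1))%N.

(* f(a_1, ..., a_{i-1}, X, a_{i+1}, ..., a_k); the value a i is unused. *)
Definition specialize_except (R : comNzRingType) (k : nat) (f : {mpoly R[k]})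
    (i : 'I_k) (a : 'I_k -> R) : {poly R} :=
  mmap (@polyC R) (fun j => if j == i then 'X else (a j)%:P) f.

Definition local_perm_poly (F : finFieldType) (k : nat) (f : {mpoly F[k]}) :
    Prop :=
  forall (i : 'I_k) (a : 'I_k -> F), perm_poly (specialize_except f i a).

Section Embedding.

Variables (p : nat) (R : nzRingType).
Hypothesis pcharR : p \in [pchar R].

Let p_pr : prime p. Proof. exact: GRing.pcharf_prime pcharR. Qed.

Lemma Fp_emb_nat m : Fp_emb R (m%:R : 'F_p) = m%:R.
Proof. by rewrite /Fp_emb val_Fp_nat // (GRing.natr_mod_pchar pcharR). Qed.

Lemma Fp_embD : {morph @Fp_emb p R : x y / x + y}.
Proof.
by move=> x y; rewrite -[x]natr_Zp -[y]natr_Zp -natrD !Fp_emb_nat natrD.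
Qed.

Lemma Fp_embM : {morph @Fp_emb p R : x y / x * y}.
Proof.
by move=> x y; rewrite -[x]natr_Zp -[y]natr_Zp -natrM !Fp_emb_nat natrM.
Qed.

Lemma Fp_emb0 : Fp_emb R (0 : 'F_p) = 0.
Proof. exact: (Fp_emb_nat 0). Qed.

Lemma Fp_emb1 : Fp_emb R (1 : 'F_p) = 1.
Proof. exact: (Fp_emb_nat 1). Qed.

Lemma Fp_emb_inj : injective (@Fp_emb p R).
Proof.
suff emb_eq0 x : Fp_emb R x = 0 -> x = 0 :> 'F_p.
  move=> x y exy; apply/eqP; rewrite -subr_eq0; apply/eqP/emb_eq0.
  by apply: (addIr (Fp_emb R y)); rewrite -Fp_embD subrK add0r.
move=> /eqP; rewrite /Fp_emb -(GRing.dvdn_pcharf pcharR) => p_dv_x.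
by rewrite -[x]natr_Zp; apply/val_inj; rewrite /= val_Fp_nat //; apply/eqP.
Qed.

End Embedding.

Section ExistsUnique.

Variables (p : nat) (Fq : finFieldType).
Hypothesis pcharFq : p \in [pchar Fq].

Local Notation q := #|Fq|.
Local Notation S n := (\sum_(a : Fq) ('X + a%:P) ^+ n).
Local Notation h := ('X^q - 'X : {poly Fq}).
Local Notation embP := (map_poly (@Fp_emb p Fq)).

Lemma size_gnq_arg : size h = q.+1.
Proof.
by rewrite size_polyDl size_polyXn // size_polyN size_polyX ltnS finNzRing_gt1.
Qed.

Lemma power_sum_rec n : S (n + q) = S n.+1 + S n * h.
Proof.
rewrite mulr_suml -big_split; apply: eq_bigr => a _ /=.
have -> : ('X + a%:P) ^+ (n + q) = ('X + a%:P) ^+ n * ('X^q + a%:P).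
  have oF : q = (p ^ logn p q)%N := card_pprimeChar pcharFq.
  have p_pr := GRing.pcharf_prime pcharFq.
  rewrite exprD; congr (_ * _).
  rewrite GRing.exprDn_pchar -?polyC_exp ?expf_card //.
  by rewrite oF pnatX pnatE // pchar_poly pcharFq.
by rewrite exprSr -mulrDr; congr (_ * _); rewrite [RHS]addrC addrA subrK.
Qed.

Lemma power_sum_small n : (n < q)%N -> S n = (\sum_(a : Fq) a ^+ n)%:P.
Proof.
move=> n_lt_q; apply/eqP; rewrite -subr_eq0; apply/negPn/negP => nz.
have S_roots : all (root (S n - (\sum_(a : Fq) a ^+ n)%:P)) (enum Fq).
  apply/allP => b _; rewrite rootE !hornerE horner_sum subr_eq0; apply/eqP.
  rewrite [RHS](reindex_inj (addrI b)) /=.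
  by apply: eq_bigr => a _; rewrite !hornerE.
have := max_poly_roots nz S_roots (enum_uniq _); rewrite -cardE.
apply/negP; rewrite -leqNgt (leq_trans _ n_lt_q) //.
apply: leq_trans (size_polyD _ _) _; rewrite geq_max size_polyN.
rewrite (leq_trans (size_polyC_leq1 _)) // andbT.
apply: leq_trans (size_sum _ _ _) _; apply/bigmax_leqP => a _.
by rewrite -[a]opprK polyCN size_exp_XsubC.
Qed.

Lemma power_sum_natr n : exists m, \sum_(a : Fq) a ^+ n = m%:R.
Proof.
have [/forallP a_n1|] := boolP [forall a : Fq, (a != 0) ==> (a ^+ n == 1)].
  exists ((n == 0) + q.-1)%N; rewrite (bigD1 0) //= expr0n natrD; congr (_ + _).
  rewrite (eq_bigr (fun=> 1)) => [|a nza]; last first.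
    by apply/eqP; apply: (implyP (a_n1 a)).
  by rewrite sumr_const -(cardC1 (0 : Fq)).
rewrite negb_forall => /existsP[b]; rewrite negb_imply => /andP[nzb bn1].
exists 0%N; apply/eqP; have: (b ^+ n - 1) * (\sum_(a : Fq) a ^+ n) == 0.
  rewrite mulrBl mul1r subr_eq0 mulr_sumr [X in _ == X](reindex_inj (mulfI nzb)).
  by apply/eqP; apply: eq_bigr => a _; rewrite exprMn.
by rewrite mulf_eq0 subr_eq0 (negPf bn1).
Qed.

Lemma gnq_exists n : exists g : {poly 'F_p}, is_gnq Fq n g.
Proof.
have cemb r i : (embP r)`_i = Fp_emb Fq r`_i.
  by rewrite coef_map_id0 ?Fp_emb0.
elim/ltn_ind: n => n IHn; have [n_lt_q | q_le_n] := ltnP n q.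
  have [m Em] := power_sum_natr n; exists (m%:R)%:P.
  rewrite /is_gnq power_sum_small // Em.
  suff -> : embP (m%:R)%:P = (m%:R)%:P by rewrite comp_polyC.
  apply/polyP => i; rewrite cemb !coefC.
  by case: eqP => _; rewrite ?Fp_emb_nat ?Fp_emb0.
have [g1 Eg1] : exists g : {poly 'F_p}, is_gnq Fq (n - q).+1 g.
  by apply: IHn; rewrite -[ltnRHS](subnK q_le_n) -addn1 ltn_add2l finNzRing_gt1.
have [g0 Eg0] : exists g : {poly 'F_p}, is_gnq Fq (n - q) g.
  by apply: IHn; rewrite ltn_subrL ltnW ?finNzRing_gt1 // (leq_trans _ q_le_n)
    // ltnW ?finNzRing_gt1.
exists (g1 + g0 * 'X); rewrite /is_gnq -{1}(subnK q_le_n) power_sum_rec Eg1 Eg0.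
suff -> : embP (g1 + g0 * 'X) = embP g1 + embP g0 * 'X.
  by rewrite comp_polyD comp_polyM comp_polyX.
apply/polyP => i; rewrite cemb !coefD !coefMX Fp_embD // !cemb.
by case: eqP => _ //; rewrite Fp_emb0.
Qed.

Lemma gnq_exists_unique n : exists! g : {poly 'F_p}, is_gnq Fq n g.
Proof.
have [g Eg] := gnq_exists n; exists g; split=> // g' Eg'.
have cemb r i : (embP r)`_i = Fp_emb Fq r`_i.
  by rewrite coef_map_id0 ?Fp_emb0.
apply/polyP => i; apply: (Fp_emb_inj pcharFq); rewrite -!cemb.
suff -> : embP g = embP g' by [].
apply/eqP; rewrite -subr_eq0 -(@comp_poly_eq0 _ _ h).
  by rewrite comp_polyB -Eg -Eg' subrr.
by rewrite size_gnq_arg ltnS ltnW ?finNzRing_gt1.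
Qed.

End ExistsUnique.

(* Main.v *)
Require Import Defs.
From mathcomp Require Import all_boot all_order all_algebra all_field.
From mathcomp Require Import mpoly.

(** Nothing about g_{n,q} matters beyond its being a polynomial g over F_Q.
    Since l is prime to Q - 1, x |-> x^l permutes F_Q, so every fibre of
    v |-> v_1^l + ... + v_k^l has the same cardinality Q^(k-1): changing v_1
    moves one fibre onto another. Hence g(v_1^l + ... + v_k^l) = alpha has
    Q^(k-1) times as many solutions as g(y) = alpha. Freezing all variables but
    one leaves g composed with a translation and x |-> x^l. *)

Import GRing.Theory.
Local Open Scope ring_scope.

(** Evaluation at a point and [specialize_except] are both instances of [mmap], so this one
    computation serves parts (a) and (b). *)
Lemma mmap_power_sum_subst (R S : comNzRingType) (h : {rmorphism R -> S})
    (k l : nat) (v : 'I_k -> S) (f : {poly R}) :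
  mmap h v (power_sum_subst k l f) = (map_poly h f).[\sum_(i < k) v i ^+ l].
Proof.
rewrite /power_sum_subst -(horner_map (mmap h v)) -map_poly_comp.
congr (_.[_]); first by apply: eq_map_poly => c /=; rewrite mmapC.
by rewrite rmorph_sum; apply: eq_bigr => i _; rewrite rmorphXn /= mmapX mmap1U.
Qed.

Lemma meval_power_sum_subst (R : comNzRingType) (k l : nat) (v : 'I_k -> R)
    (f : {poly R}) :
  (power_sum_subst k l f).@[v] = f.[\sum_(i < k) v i ^+ l].
Proof. by rewrite /meval mmap_power_sum_subst map_poly_id. Qed.

Lemma horner_specialize_power_sum (R : comNzRingType) (k l : nat)
    (f : {poly R}) (i : 'I_k) (a : 'I_k -> R) (x : R) :
  (specialize_except (power_sum_subst k l f) i a).[x] =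
  f.[x ^+ l + \sum_(j < k | j != i) a j ^+ l].
Proof.
rewrite /specialize_except mmap_power_sum_subst -/(f \Po _) horner_comp.
congr (_.[_]); rewrite horner_sum (bigD1 i) //= eqxx !hornerE; congr (_ + _).
by apply: eq_bigr => j /negPf->; rewrite !hornerE.
Qed.

Lemma expf_bij (F : finFieldType) (l : nat) :
  (0 < l)%N -> coprime l (#|F| - 1) -> bijective (fun x : F => x ^+ l).
Proof.
move=> l_gt0 /eqP co_l; apply: injF_bij.
(* Bezout: [u * l = w * (#|F| - 1) + 1], so raising to the power [u] undoes raising to the power
   [l]. *)
case: (egcdnP (#|F| - 1) l_gt0) => u w; rewrite co_l => Eu _.
apply: (can_inj (g := fun y => y ^+ u)) => x.
rewrite -exprM mulnC Eu exprD expr1.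
have [->|nz_x] := eqVneq x 0; first by rewrite mulr0.
suff x1 : x ^+ (#|F| - 1) = 1 by rewrite mulnC exprM x1 expr1n mul1r.
apply: (mulIf nz_x); rewrite mul1r -exprSr subn1 prednK ?expf_card //.
exact: ltnW (finNzRing_gt1 F).
Qed.

(** Count fibre by fibre. With [predT] this determines the common fibre size of the power sum; with
    the predicate [f.[y] == alpha] it counts solutions. *)
Lemma card_preim_const (T U : finType) (h : T -> U) (P : pred U) (N : nat) :
  (forall c, #|[set v | h v == c]| = N) ->
  #|[set v | P (h v)]| = (#|[set y | P y]| * N)%N.
Proof.
move=> hN; rewrite -[LHS]sum1_card (partition_big h P) /= => [|v]; last by rewrite inE.
rewrite -sum_nat_const [RHS](eq_bigl P) => [|y]; last by rewrite inE.
apply: eq_bigr => c Pc; rewrite -(hN c) -sum1_card; apply: eq_bigl => v.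
by rewrite !inE andb_idl // => /eqP->.
Qed.

Lemma card_power_sum_fiber (F : finFieldType) (k l : nat) (c : F) :
  (0 < k)%N -> bijective (fun x : F => x ^+ l) ->
  #|[set v : {ffun 'I_k -> F} | \sum_(i < k) v i ^+ l == c]| =
    (#|F| ^ (k - 1))%N.
Proof.
case: k => // k _ [r lK rK]; rewrite subn1 /=.
pose N (c : F) :=
  #|[set v : {ffun 'I_k.+1 -> F} | \sum_(i < k.+1) v i ^+ l == c]|.
have leN c1 c2 : (N c1 <= N c2)%N.
  (* Replacing the first coordinate by the [l]-th root of [v ord0 ^+ l + (c2 - c1)] shifts the power
     sum by [c2 - c1], so [t] injects the fibre of [c1] into that of [c2]. *)
  pose t (v : {ffun 'I_k.+1 -> F}) :=
    [ffun i => if i == ord0 then r (v i ^+ l + (c2 - c1)) else v i].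
  have t_inj : injective t.
    move=> v w /ffunP tvw; apply/ffunP=> i; have := tvw i; rewrite !ffunE.
    by case: (i == ord0) => // /(can_inj rK)/addIr/(can_inj lK).
  rewrite /N -(card_imset _ t_inj); apply/subset_leq_card.
  apply/subsetP => _ /imsetP[v + ->].
  rewrite !inE (bigD1 ord0) //= => /eqP sv.
  rewrite (bigD1 ord0) //= ffunE eqxx rK.
  under eq_bigr => i /negPf ni0 do rewrite ffunE ni0.
  by rewrite addrAC sv addrC subrK.
have Nc c' : N c' = N c by apply/eqP; rewrite eqn_leq !leN.
(* The [#|F|] equal fibres partition a space of [#|F| ^ k.+1] points; cancel one factor [#|F|]. *)
have := card_preim_const _ _ _ predT (N c) Nc.
rewrite !cardsT card_ffun card_ord expnS => /eqP.
rewrite eqn_pmul2l; first by move/eqP.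
exact: ltnW (finNzRing_gt1 F).
Qed.

(** Recasts [perm_poly] as a count of solutions, the form in which [mperm_poly] is stated. *)
Lemma bijective_card_fiber (T : finType) (f : T -> T) :
  bijective f <-> forall y, #|[set x | f x == y]| = 1%N.
Proof.
split=> [[g fK gK] y | f1].
  rewrite -(cards1 (g y)); congr #|pred_of_set _|; apply/setP => x.
  by rewrite !inE (can2_eq fK gK).
apply: injF_bij => x y fxy; have /eqP/cards1P[z Ez] := f1 (f y).
have : x \in [set z] by rewrite -Ez inE fxy.
have : y \in [set z] by rewrite -Ez inE.
by rewrite !inE => /eqP-> /eqP->.
Qed.

Lemma mperm_poly_power_sum (F : finFieldType) (k l : nat) (f : {poly F}) :
  (0 < k)%N -> bijective (fun x : F => x ^+ l) ->
  mperm_poly (power_sum_subst k l f) <-> perm_poly f.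
Proof.
move=> k_gt0 l_bij; rewrite /perm_poly bijective_card_fiber.
have cardE alpha :
    #|[set v : {ffun 'I_k -> F} | (power_sum_subst k l f).@[v] == alpha]| =
    (#|[set y | f.[y] == alpha]| * #|F| ^ (k - 1))%N.
  under eq_finset => v do rewrite meval_power_sum_subst.
  apply: (card_preim_const _ _ _ (fun y => f.[y] == alpha)) => c.
  exact: card_power_sum_fiber.
(* Positivity lets the factor be cancelled, which gives the forward direction. *)
have Q_gt0 : (0 < #|F| ^ (k - 1))%N.
  by rewrite expn_gt0 (ltnW (finNzRing_gt1 F)).
split=> fP alpha; last by rewrite cardE fP mul1n.
by apply/eqP; rewrite -(eqn_pmul2r Q_gt0) -cardE mul1n fP.
Qed.

Lemma local_perm_poly_power_sum (F : finFieldType) (k l : nat) (f : {poly F}) :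
  (0 < k)%N -> bijective (fun x : F => x ^+ l) ->
  local_perm_poly (power_sum_subst k l f) <-> perm_poly f.
Proof.
move=> k_gt0 l_bij; split=> [locf | f_bij i a].
  have [r lK rK] := l_bij.
  (* Freezing every variable but the first at 0 gives the bijection sending [x] to [f.[x ^+ l + s]];
     precomposing it with [r (x - s)] recovers [f]. *)
  pose i0 := Ordinal k_gt0; pose s := \sum_(j < k | j != i0) (0 : F) ^+ l.
  have r_bij : bijective (fun x : F => r (x - s)).
    by exists (fun y => y ^+ l + s) => x; rewrite ?rK ?subrK ?addrK ?lK.
  apply: (eq_bij (bij_comp (locf i0 (fun=> 0)) r_bij)) => x /=.
  by rewrite horner_specialize_power_sum rK subrK.
have addB (s : F) : bijective (fun x => x + s).
  by exists (fun x => x - s) => x; rewrite ?addrK ?subrK.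
apply: (eq_bij (bij_comp f_bij (bij_comp (addB _) l_bij))) => x /=.
by rewrite horner_specialize_power_sum.
Qed.

Theorem theorem5p9 (p m q e n k l : nat) (Fq FQ : finFieldType)
    (p_prime : prime p) (m_ge1 : (1 <= m)%N) (q_def : q = (p ^ m)%N)
    (card_Fq : #|Fq| = q)
    (e_ge1 : (1 <= e)%N) (card_FQ : #|FQ| = (q ^ e)%N)
    (k_ge1 : (1 <= k)%N) (l_ge1 : (1 <= l)%N)
    (l_coprime : coprime l (q ^ e - 1))
    (g : {poly 'F_p}) (g_def : is_gnq Fq n g) :
  let gQ : {poly FQ} := map_poly (Fp_emb FQ) g in
  (mperm_poly (power_sum_subst k l gQ) <-> perm_poly gQ) /\
  (local_perm_poly (power_sum_subst k l gQ) <-> perm_poly gQ).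
Proof.
move=> gQ; rewrite -card_FQ in l_coprime.
have l_bij := expf_bij FQ l l_ge1 l_coprime.
by split; [apply: mperm_poly_power_sum | apply: local_perm_poly_power_sum].
Qed.
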